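(* Let $n \geq 1$ and let $U \subseteq [n]\times[n]$ be a set of unspecified entries of an $n \times n$ matrix, with set of specified entries $S = ([n]\times[n])\setminus U$. Then $1$ is a typical corank of $S$ (equivalently, $n-1$ is a typical rank of $S$) if and only if one of the following holds: (1) $|U| \geq 1$ and all entries of $U$ lie in the union of a single column and a single row; (2) up to permuting rows and columns, $U = G(3,1)$, i.e. $U$ consists of exactly three entries lying in pairwise distinct rows and pairwise distinct columns; (3) up to permuting rows and columns, $U = G(4,1)$, i.e. $U$ consists of exactly four entries lying in pairwise distinct rows and pairwise distinct columns.
   Context: $[n] = \{1,\ldots,n\}$. For $S \subseteq [n]\times[n]$, a partial filling is a point $A \in \mathbb{R}^S$. A real completion of $A$ is a matrix $M \in \mathbb{R}^{n\times n}$ with $M_{ij} = A_{ij}$ for all $(i,j)\in S$. An integer $r$ is a typical rank of $S$ if there is a nonempty Euclidean open subset of $\mathbb{R}^S$ such that for every $A$ in it, the minimum rank among all real completions of $A$ equals $r$. The typical coranks of $S$ are the numbers $n - r$ with $r$ a typical rank of $S$. $G(m,1) = \{(i,i) : 1 \leq i \leq m\}$. *)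

(* Defs.v *)
From HB Require Import structures.
From mathcomp Require Import all_boot all_order all_algebra all_fingroup.
From mathcomp Require Import all_classical all_reals all_analysis.
Export numFieldNormedType.Exports.

Set Implicit Arguments.
Unset Strict Implicit.
Unset Printing Implicit Defensive.

(* R^S; since S is finite, the product topology carried by {ptws _ -> _} is
   the Euclidean one. *)
Definition partial_filling (R : realType) (n : nat) (S : {set 'I_n * 'I_n})
    : topologicalType :=
  {ptws {p : 'I_n * 'I_n | p \in S} -> R}.

Definition completion (R : realType) (n : nat) (S : {set 'I_n * 'I_n})
    (A : partial_filling R S) (M : 'M[R]_n) : Prop :=
  forall p : {p : 'I_n * 'I_n | p \in S}, M (val p).1 (val p).2 = A p.

Definition min_completion_rank (R : realType) (n : nat)
    (S : {set 'I_n * 'I_n}) (A : partial_filling R S) (r : nat) : Prop :=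
  (exists M : 'M[R]_n, completion A M /\ \rank M = r) /\
  (forall M : 'M[R]_n, completion A M -> r <= \rank M).

Definition typical_rank (R : realType) (n : nat) (S : {set 'I_n * 'I_n})
    (r : nat) : Prop :=
  exists O : set (partial_filling R S),
    [/\ open O, (O !=set0)%classic &
        forall A : partial_filling R S, O A -> min_completion_rank A r].

(* A typical rank is at most n, so the subtraction does not truncate. *)
Definition typical_corank (R : realType) (n : nat) (S : {set 'I_n * 'I_n})
    (k : nat) : Prop :=
  exists r : nat, typical_rank R S r /\ k = n - r.

(* G(m,1) as a set of positions of an n x n matrix, which requires m <= n. *)
Definition G1 (m n : nat) (le_mn : m <= n) : {set 'I_n * 'I_n} :=
  [set (widen_ord le_mn i, widen_ord le_mn i) | i : 'I_m]%SET.

Definition permute_positions (n : nat) (s t : 'S_n) (U : {set 'I_n * 'I_n})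
    : {set 'I_n * 'I_n} :=
  [set (s p.1, t p.2) | p in U]%SET.

Definition equals_G1_up_to_perm (n : nat) (U : {set 'I_n * 'I_n}) (m : nat)
    : Prop :=
  exists (le_mn : m <= n) (s t : 'S_n), permute_positions s t U = G1 le_mn.

Definition in_one_row_and_column (n : nat) (U : {set 'I_n * 'I_n}) : Prop :=
  exists i j : 'I_n, forall p : 'I_n * 'I_n, p \in U -> p.1 = i \/ p.2 = j.

(* Main.v *)
(** Everything takes place in the space of matrices: an open set of partial
fillings pulls back to an open set O of matrices, closed under arbitrary
changes of the entries in U, and one asks which ranks occur in O.

Sufficiency. If the cofactor of an entry in U does not vanish, then changing
this entry makes the matrix singular, so it suffices to keep the rank from
dropping to n - 2 on an open set. If U is contained in row i and column j, the
cofactor (i, j) is specified, and it is enough that it does not vanish. If U =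
G(m,1) with m = 3 or 4, a Schur complement reduces to n = m. A 3 x 3 matrix of
rank 1 satisfies x12 x23 x31 = x13 x21 x32; for a 4 x 4 matrix of rank 2, two
off-diagonal 3 x 3 minors give two bilinear equations in the first two
diagonal entries, whose eliminant has no real root on an open set.

Necessity. One finds in O a matrix of rank at most n - 2. If U has two entries
in row r and is not contained in a row and a column, it has two entries
outside row r in different columns; after a perturbation these are used to
create a linear relation among the rows other than r, and the entries in row r
to create a second relation. If no two entries of U share a row or a column,
then |U| >= 5 remains, and one reduces to U = G(5,1) and n = 5. Write the
matrix as [P b; c x]. For v with c v = 0 and nonzero entries, choose the
diagonal of P such that P v = 0. If moreover w P = 0 and w b = 0 for some w <>
0, a perturbation of P and a suitable x give rank 3. Such a w exists when a
cubic form in v vanishes, and an odd-degree form has real zeros. *)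
Require Import Defs.
From mathcomp Require Import all_boot all_order all_algebra all_fingroup.
From mathcomp Require Import all_classical all_reals all_analysis.
From mathcomp Require Import zify ring lra.

Set Implicit Arguments.
Unset Strict Implicit.
Unset Printing Implicit Defensive.

Import Order.TTheory GRing.Theory Num.Theory.
Local Open Scope ring_scope.

(** * Perturbation inside a set of matrices *)

(* All that is used of an open set: along every line through one of its points,
   it contains points avoiding the zeros of any given nonzero polynomial. *)
Definition line_open (R : fieldType) m n (O : 'M[R]_(m, n) -> Prop) :=
  forall M N (p : {poly R}), O M -> p != 0 ->
  exists2 t, p.[t] != 0 & O (M + t *: N).

Definition saturated (R : fieldType) n (U : {set 'I_n * 'I_n})
    (O : 'M[R]_n -> Prop) :=
  forall M M' : 'M[R]_n, O M ->
  (forall i j, (i, j) \notin U -> M' i j = M i j) -> O M'.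

Lemma horner_char_poly (R : fieldType) n (A : 'M[R]_n) t :
  (char_poly A).[t] = \det (t%:M - A).
Proof.
rewrite /char_poly -[LHS]/(horner_eval t _) -det_map_mx; congr (\det _).
by apply/matrixP=> i j; rewrite !mxE /= /horner_eval hornerD hornerN hornerC
  hornerMn hornerX.
Qed.

Lemma shift_unitmx (R : fieldType) n (A : 'M[R]_n) :
  exists2 p : {poly R}, p != 0 &
    forall t, p.[t] != 0 -> A + t%:M \in unitmx.
Proof.
exists (char_poly (- A)); first exact/monic_neq0/char_poly_monic.
by move=> t; rewrite horner_char_poly opprK addrC unitmxE unitfE.
Qed.

Lemma line_open_unitmx (R : fieldType) n (O : 'M[R]_n -> Prop) M :
  line_open O -> O M -> exists2 M', M' \in unitmx & O M'.
Proof.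
move=> Oop OM; have [p p0 pP] := shift_unitmx M.
have [t pt Ot] := Oop M 1%:M p OM p0.
by exists (M + t%:M); [exact: pP | rewrite -scalemx1].
Qed.

Lemma mul_row_delta (R : fieldType) n m (w : 'rV[R]_n) (p : 'I_n) (q : 'I_m) :
  w *m delta_mx p q = w 0 p *: delta_mx 0 q.
Proof.
apply/rowP=> j; rewrite !mxE (bigD1 p) //= mxE eqxx /= big1 ?addr0 //.
by move=> i /negPf ip; rewrite mxE ip mulr0.
Qed.

(** * Two unspecified entries in the same row or column *)

(** Replacing column [q1] by the unit vector at [r] and column [q2] by zero gives a singular matrix;
    take [w] in its left kernel. Its column [q1] forces [w 0 r = 0]. *)
Lemma exists_row_relation (R : fieldType) n (M : 'M[R]_n) r q1 q2 :
  q1 != q2 ->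
  exists w : 'rV_n, [/\ w != 0, w 0 r = 0 &
    forall j, j != q1 -> j != q2 -> (w *m M) 0 j = 0].
Proof.
move=> q12.
pose N := \matrix_(i, j)
  if j == q1 then (i == r)%:R else if j == q2 then 0 else M i j : R.
have /eqP/det0P[w w0 wN] : \det N = 0.
  rewrite (expand_det_col _ q2) big1 // => i _.
  by rewrite mxE eq_sym (negPf q12) eqxx mul0r.
have wNj j : \sum_i w 0 i * N i j = 0.
  by move/rowP/(_ j): wN; rewrite !mxE.
exists w; split => //.
  have := wNj q1; rewrite (bigD1 r) //= big1 ?addr0 ?mxE ?eqxx ?mulr1 //.
  by move=> i /negPf ir; rewrite mxE eqxx ir mulr0.
move=> j /negPf j1 /negPf j2; rewrite mxE; apply: etrans (wNj j).
by apply: eq_bigr => i _; rewrite !mxE j1 j2.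
Qed.

(* E = y e_p squares to zero, so 1 + tE and 1 - tE are mutually inverse. *)
Lemma transvection (R : fieldType) k n m (W : 'M[R]_(k, n)) (M : 'M[R]_(n, m))
    (y : 'cV[R]_n) (p : 'I_n) t : y p 0 = 0 ->
  (W + t *: (W *m y *m delta_mx 0 p)) *m (M - t *: (y *m (delta_mx 0 p *m M)))
  = W *m M.
Proof.
move=> yp; have dy : (delta_mx 0 p : 'rV[R]_n) *m y = 0.
  by apply/matrixP=> i j; rewrite -rowE !mxE !ord1.
rewrite mulmxBr !mulmxDl -!scalemxAl -!scalemxAr !mulmxA.
have -> : W *m y *m delta_mx 0 p *m y = 0 by rewrite -!mulmxA dy !mulmx0.
by rewrite !mul0mx !scaler0 addr0 addrK.
Qed.

(** If [w 0 p = 0], take [y] supported at a nonzero coordinate of [w], scaled so that [w y = 1]; the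
    transvection then adds [t] to coordinate [p]. *)
Lemma perturb_relation (R : fieldType) n (O : 'M[R]_n -> Prop) M
    (w : 'rV[R]_n) p :
  line_open O -> O M -> w != 0 ->
  exists M' w', [/\ O M', w' *m M' = w *m M, w' 0 p != 0 &
    forall i, i != p -> w' 0 i = w 0 i].
Proof.
move=> Oop OM w0; have [wp|wp] := eqVneq (w 0 p) 0; last by exists M, w.
have [k wk] : exists k, w 0 k != 0.
  by apply/rV0Pn: w0.
have kp : k != p by apply: contraNneq wk => ->; rewrite wp.
pose y : 'cV[R]_n := (w 0 k)^-1 *: delta_mx k 0.
have yp : y p 0 = 0 by rewrite !mxE eq_sym (negPf kp) mulr0.
have wy : w *m y = 1%:M.
  rewrite -scalemxAr mul_row_delta scalerA mulVf // scale1r.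
  by apply/matrixP=> i j; rewrite !ord1 !mxE.
have [t pt Ot] := Oop M (- (y *m (delta_mx 0 p *m M))) 'X OM
  (negbT (polyX_eq0 _)).
rewrite hornerX in pt.
exists (M - t *: (y *m (delta_mx 0 p *m M))),
  (w + t *: (w *m y *m delta_mx 0 p)); split.
- by rewrite -scalerN.
- exact: transvection.
- by rewrite wy mul1mx !mxE !eqxx wp mulr1 add0r.
- by move=> i /negPf ip; rewrite wy mul1mx !mxE ip mulr0 addr0.
Qed.

Definition fix_entries (R : fieldType) n (w : 'rV[R]_n) (M : 'M[R]_n)
    (p1 q1 p2 q2 : 'I_n) : 'M[R]_n :=
  M - ((w *m M) 0 q1 / w 0 p1) *: delta_mx p1 q1
    - ((w *m M) 0 q2 / w 0 p2) *: delta_mx p2 q2.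

Lemma fix_entriesP (R : fieldType) n (w : 'rV[R]_n) (M : 'M[R]_n) p1 q1 p2 q2 :
  q1 != q2 -> w 0 p1 != 0 -> w 0 p2 != 0 ->
  (forall j, j != q1 -> j != q2 -> (w *m M) 0 j = 0) ->
  w *m fix_entries w M p1 q1 p2 q2 = 0.
Proof.
move=> q12 w1 w2 wM; rewrite !mulmxBr -!scalemxAr !mul_row_delta !scalerA.
rewrite !divfK //; move: (w *m M) wM => u uj; apply/rowP=> j.
rewrite !mxE !mulr_natr eqxx /=.
have [->|j1] := eqVneq j q1.
  by rewrite (negPf q12) mulr1n mulr0n subr0 subrr.
have [->|j2] := eqVneq j q2; first by rewrite mulr1n mulr0n subr0 subrr.
by rewrite uj // !mulr0n !subr0.
Qed.

Lemma fix_entries_saturated (R : fieldType) n U (O : 'M[R]_n -> Prop)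
    (w : 'rV[R]_n) (M : 'M[R]_n) p1 q1 p2 q2 :
  saturated U O -> (p1, q1) \in U -> (p2, q2) \in U ->
  O M -> O (fix_entries w M p1 q1 p2 q2).
Proof.
move=> Os U1 U2 OM; apply: Os OM _ => i j nU; rewrite /fix_entries.
move: (_ / _) (_ / _) => a b; rewrite !mxE.
have -> : (i == p1) && (j == q1) = false.
  by apply: contraNF nU => /andP[/eqP-> /eqP->].
have -> : (i == p2) && (j == q2) = false.
  by apply: contraNF nU => /andP[/eqP-> /eqP->].
by rewrite !mulr0 !subr0.
Qed.

(** Coordinate [k] shows that [w] and [w'] are linearly independent in the left kernel. *)
Lemma two_relations_rank (R : fieldType) n (M : 'M[R]_n) (w w' : 'rV[R]_n) k :
  w 0 k != 0 -> w' 0 k = 0 -> w' != 0 -> w *m M = 0 -> w' *m M = 0 ->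
  (\rank M + 2 <= n)%N.
Proof.
move=> wk w'k w'0 wM w'M.
have WM : col_mx w w' *m M = 0 by rewrite mul_col_mx wM w'M col_mx0.
have /eqP rW : row_free (col_mx w w').
  apply: inj_row_free => v; rewrite -[v]hsubmxK mul_row_col.
  rewrite [lsubmx v]mx11_scalar [rsubmx v]mx11_scalar !mul_scalar_mx.
  move: (lsubmx v 0 0) (rsubmx v 0 0) => a b e.
  have /eqP := congr1 (fun u : 'rV_n => u 0 k) e.
  rewrite !mxE w'k mulr0 addr0 mulf_eq0 (negPf wk) orbF => /eqP a0.
  move/eqP: e; rewrite a0 scale0r add0r scaler_eq0 (negPf w'0) orbF => /eqP ->.
  by rewrite !raddf0 row_mx0.
by have := mulmx0_rank_max WM; rewrite rW addnC.
Qed.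

(* First a relation w among the rows other than r is created with the entries
   (p1, q1) and (p2, q2), then a second relation, involving row r, with the
   entries (r, j1) and (r, j2); the latter do not affect the former. *)
Lemma corank2_row (R : fieldType) n U (O : 'M[R]_n -> Prop) M
    r j1 j2 p1 q1 p2 q2 :
  line_open O -> saturated U O -> O M ->
  (r, j1) \in U -> (r, j2) \in U -> (p1, q1) \in U -> (p2, q2) \in U ->
  j1 != j2 -> q1 != q2 -> p1 != r -> p2 != r ->
  exists2 M', O M' & (\rank M' + 2 <= n)%N.
Proof.
move=> Oop Os OM Uj1 Uj2 U1 U2 j12 q12 p1r p2r.
have [w [w0 wr wM]] := exists_row_relation M r q12.
have [M1 [w1 [OM1 wM1 w1p w1E]]] := perturb_relation p1 Oop OM w0.
have w10 : w1 != 0 by apply: contraNneq w1p => ->; rewrite mxE.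
have [M2 [w2 [OM2 wM2 w2p w2E]]] := perturb_relation p2 Oop OM1 w10.
have w2p1 : w2 0 p1 != 0 by have [->|?] := eqVneq p1 p2; rewrite // w2E.
have w2r : w2 0 r = 0 by rewrite w2E ?w1E // eq_sym.
have w2M j : j != q1 -> j != q2 -> (w2 *m M2) 0 j = 0.
  by rewrite wM2 wM1; apply: wM.
have OM3 := fix_entries_saturated w2 Os U1 U2 OM2.
have := fix_entriesP q12 w2p1 w2p w2M.
move: (fix_entries _ _ _ _ _ _) OM3 => M3 OM3 wM3.
(* Vanishing at [p1], where [w2] does not, keeps the new relation independent of [w2]. *)
have [u [u0 up uM]] := exists_row_relation M3 p1 j12.
have [M4 [u' [OM4 wM4 u'r u'p u'M]]] :
    exists (M4 : 'M[R]_n) (u' : 'rV_n), [/\ O M4,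
    w2 *m M4 = 0, u' 0 r != 0, u' 0 p1 = 0 &
    forall j, j != j1 -> j != j2 -> (u' *m M4) 0 j = 0].
  have [ur|ur] := eqVneq (u 0 r) 0; last by exists M3, u.
  have [l ul] : exists l, u 0 l != 0 by apply/rV0Pn.
  have lr : l != r by apply: contraNneq ul => ->; rewrite ur.
  (* Here [u y = 1] and [w2 y = 0]: the transvection makes coordinate [r] of [u] nonzero and
     preserves the relation [w2]. *)
  pose y : 'cV[R]_n :=
    (u 0 l)^-1 *: (delta_mx l 0 - (w2 0 l / w2 0 p1) *: delta_mx p1 0).
  have yr : y r 0 = 0.
    by rewrite !mxE !(eq_sym r) (negPf lr) (negPf p1r) /=; ring.
  have d11 : delta_mx 0 0 = 1%:M :> 'M[R]_1.
    by apply/matrixP=> i j; rewrite !ord1 !mxE.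
  have wy : w2 *m y = 0.
    rewrite -scalemxAr mulmxBr -scalemxAr !mul_row_delta scalerA divfK //.
    by rewrite subrr scaler0.
  have uy : u *m y = 1%:M.
    rewrite -scalemxAr mulmxBr -scalemxAr !mul_row_delta up scale0r scaler0.
    by rewrite subr0 scalerA mulVf // scale1r d11.
  have [t] := Oop M3 (- (y *m (delta_mx 0 r *m M3))) 'X OM3
    (negbT (polyX_eq0 _)).
  rewrite hornerX scalerN => t0 Ot.
  exists (M3 - t *: (y *m (delta_mx 0 r *m M3))),
    (u + t *: (u *m y *m delta_mx 0 r)); split => //.
  - have := transvection w2 M3 t yr.
    by rewrite wy mul0mx scaler0 addr0 => ->.
  - by rewrite uy mul1mx !mxE !eqxx ur mulr1 add0r.
  - by rewrite uy mul1mx !mxE up (negPf p1r) mulr0 addr0.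
  - by move=> j j1j j2j; rewrite transvection // uM.
exists (fix_entries u' M4 r j1 r j2).
  exact: fix_entries_saturated Os _ _ OM4.
apply: (two_relations_rank w2p1 u'p); last exact: fix_entriesP.
  by apply: contraNneq u'r => ->; rewrite mxE.
by rewrite !mulmxBr -!scalemxAr !mul_row_delta wM4 w2r !scale0r !scaler0 !subr0.
Qed.

Lemma corank2_col (R : fieldType) n U (O : 'M[R]_n -> Prop) M
    r j1 j2 p1 q1 p2 q2 :
  line_open O -> saturated U O -> O M ->
  (j1, r) \in U -> (j2, r) \in U -> (q1, p1) \in U -> (q2, p2) \in U ->
  j1 != j2 -> q1 != q2 -> p1 != r -> p2 != r ->
  exists2 M', O M' & (\rank M' + 2 <= n)%N.
Proof.
move=> Oop Os OM Uj1 Uj2 U1 U2 j12 q12 p1r p2r.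
pose O' := fun M : 'M[R]_n => O M^T.
pose U' := [set p | (p.2, p.1) \in U].
have O'op : line_open O'.
  move=> N1 N2 p ON p0; have [t pt Ot] := Oop _ N2^T p ON p0.
  by exists t; rewrite // /O' !linearE.
have O's : saturated U' O'.
  move=> N1 N2 ON N12; apply: Os ON _ => i j ij.
  by rewrite !mxE N12 // inE.
have OMt : O' M^T by rewrite /O' trmxK.
have inU i j : (i, j) \in U -> (j, i) \in U' by rewrite inE.
have [M' OM' rM'] := corank2_row O'op O's OMt (inU _ _ Uj1) (inU _ _ Uj2)
  (inU _ _ U1) (inU _ _ U2) j12 q12 p1r p2r.
by exists M'^T; rewrite // mxrank_tr.
Qed.

(** * Five unspecified entries in distinct rows and columns *)

Lemma row_kernel_basis (R : fieldType) m (v : 'cV[R]_m.+1) : v != 0 ->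
  exists2 C : 'M[R]_(m, m.+1), row_free C &
    forall k (u : 'M[R]_(k, m.+1)), u *m v = 0 -> exists u', u = u' *m C.
Proof.
move=> v0; have rv : \rank (kermx v) = m.
  have : (0 < \rank v)%N by rewrite lt0n mxrank_eq0.
  by rewrite mxrank_ker; case: (\rank v) (rank_leq_col v) => [|[|]] //; lia.
(* Stating the row count as a rank avoids a cast. *)
suff: exists2 C : 'M[R]_(\rank (kermx v), m.+1), row_free C &
    forall k (u : 'M[R]_(k, m.+1)), u *m v = 0 -> exists u', u = u' *m C.
  by rewrite rv.
exists (row_base (kermx v)); first exact: row_base_free.
by move=> k u /sub_kermxP uv; apply/submxP; rewrite eq_row_base.
Qed.

(* Factor P = L H C through the kernels of w and v; once H is made invertible,
   the corner entry c H^-1 b makes the matrix factor through H. *)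
Lemma corank2_bordered (R : fieldType) m
    (O : 'M[R]_(m.+1 + 1) -> Prop) P b c x (v : 'cV[R]_m.+1)
    (w : 'rV[R]_m.+1) :
  line_open O ->
  (forall P b c x x', O (block_mx P b c x) -> O (block_mx P b c x')) ->
  O (block_mx P b c x) ->
  v != 0 -> w != 0 -> P *m v = 0 -> c *m v = 0 -> w *m P = 0 -> w *m b = 0 ->
  exists2 M, O M & (\rank M <= m)%N.
Proof.
move=> Oop Os OM v0 w0 Pv cv wP wb.
have [C Cfree Cv] := row_kernel_basis v0.
have wt0 : w^T != 0 by rewrite trmx_eq0.
have [L _ Lw] := row_kernel_basis wt0.
have Lw' k (u : 'M[R]_(m.+1, k)) : w *m u = 0 -> exists u', u = L^T *m u'.
  move=> wu; have [|u' uE] := Lw _ u^T; first by rewrite -trmx_mul wu trmx0.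
  by exists u'^T; rewrite -trmx_mul -uE trmxK.
have [P' PE] := Cv _ _ Pv; have [c' cE] := Cv _ _ cv.
have [H HE] : exists H, P' = L^T *m H.
  by apply: Lw'; apply: (row_free_inj Cfree); rewrite mul0mx -mulmxA -PE.
have [b' bE] := Lw' _ _ wb.
have [p p0 pP] := shift_unitmx H.
(* Moving [P] along [L^T C] shifts [H] by [t] times the identity and keeps both kernel relations. *)
have [t pt Ot] := Oop _ (block_mx (L^T *m C) 0 0 0) p OM p0.
set K := H + t%:M in pP; have Ku := pP t pt.
exists (block_mx (L^T *m K *m C) b c (c' *m invmx K *m b')).
  move: Ot; rewrite scale_block_mx !scaler0 add_block_mx !addr0.
  have -> : P + t *: (L^T *m C) = L^T *m K *m C; last exact: Os.
  by rewrite PE HE /K mulmxDr mul_mx_scalar mulmxDl -scalemxAl.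
have -> : block_mx (L^T *m K *m C) b c (c' *m invmx K *m b') =
    col_mx (L^T *m K) c' *m (invmx K *m row_mx (K *m C) b').
  by rewrite mul_mx_row mul_col_row !mulmxA mulmxK // mulmxKV // bE cE.
exact: mulmx_max_rank.
Qed.

(** * Explicit determinants and the cubic form *)

Lemma det3E (R : comNzRingType) (a : nat -> nat -> R) :
  \det (\matrix_(i < 3, j < 3) a i j) =
    a 0%N 0%N * (a 1%N 1%N * a 2%N 2%N - a 1%N 2%N * a 2%N 1%N)
    - a 0%N 1%N * (a 1%N 0%N * a 2%N 2%N - a 1%N 2%N * a 2%N 0%N)
    + a 0%N 2%N * (a 1%N 0%N * a 2%N 1%N - a 1%N 1%N * a 2%N 0%N).
Proof.
rewrite !(expand_det_row _ ord0) !big_ord_recl big_ord0 /cofactor.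
rewrite !(expand_det_row _ ord0) !big_ord_recl !big_ord0 /cofactor.
rewrite !det_mx11 !mxE /=.
rewrite /bump /=; ring.
Qed.

Lemma det4E (R : comNzRingType) (a : nat -> nat -> R) :
  \det (\matrix_(i < 4, j < 4) a i j) =
    let d (f g h : nat -> R) := f 0%N * (g 1%N * h 2%N - g 2%N * h 1%N)
      - f 1%N * (g 0%N * h 2%N - g 2%N * h 0%N)
      + f 2%N * (g 0%N * h 1%N - g 1%N * h 0%N) in
    - a 0%N 3%N * d (a 1%N) (a 2%N) (a 3%N)
    + a 1%N 3%N * d (a 0%N) (a 2%N) (a 3%N)
    - a 2%N 3%N * d (a 0%N) (a 1%N) (a 3%N)
    + a 3%N 3%N * d (a 0%N) (a 1%N) (a 2%N).
Proof.
rewrite (expand_det_row _ ord0) !big_ord_recl big_ord0 /cofactor.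
do 2 rewrite !(expand_det_row _ ord0) !big_ord_recl !big_ord0 /cofactor.
rewrite !det_mx11 !mxE /=.
rewrite /bump /=; ring.
Qed.

Definition offdiag_sum (R : comNzRingType) (p : nat -> nat -> R)
    (v : nat -> R) (i : nat) : R :=
  \sum_(k < 4) (if (k : nat) == i then 0 else p i k * v k).

(* If Q is p with its diagonal changed so that Q v = 0, these are the first
   three columns of Q diag(v), followed by b. *)
Definition cubic_mx (R : comNzRingType) (p : nat -> nat -> R)
    (b v : nat -> R) : 'M[R]_4 :=
  \matrix_(i < 4, j < 4) (fun i j : nat => if j == 3%N then b i
    else if i == j then - offdiag_sum p v i else p i j * v j) i j.

(* These are vectors orthogonal to c. *)
Definition orth_point (R : comNzRingType) (c : nat -> R) (s y : R) : nat -> R :=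
  nth 0 [:: c 1%N * s; - (c 0%N * s); c 3%N * y; - (c 2%N * y)].

Lemma horner_det_cubic (R : comNzRingType) (p : nat -> nat -> R)
    (b c : nat -> R) (s y : {poly R}) t :
  (\det (cubic_mx (fun i j => (p i j)%:P) (fun i => (b i)%:P)
     (orth_point (fun i => (c i)%:P) s y))).[t] =
  \det (cubic_mx p b (orth_point c s.[t] y.[t])).
Proof.
rewrite -[LHS]/(horner_eval t _) -det_map_mx; congr (\det _).
have vE j : (orth_point (fun i => (c i)%:P) s y j).[t] =
    orth_point c s.[t] y.[t] j.
  by case: j => [|[|[|[|j]]]]; 
    rewrite /orth_point /= ?hornerE ?nth_nil ?horner0.
apply/matrixP=> i j; rewrite !mxE /= /horner_eval.
case: ifP => _; first by rewrite hornerC.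
case: ifP => _; last by rewrite hornerM hornerC vE.
rewrite hornerN horner_sum; congr (- _); apply: eq_bigr => k _.
by case: ifP; rewrite ?horner0 // hornerM hornerC vE.
Qed.

(** Three columns are linear in [v] and the last is constant, so the determinant is an odd function
    of [v]. *)
Lemma det_cubicN (R : comNzRingType) (p : nat -> nat -> R) (b c : nat -> R)
    s y :
  \det (cubic_mx p b (orth_point c (- s) (- y))) =
  - \det (cubic_mx p b (orth_point c s y)).
Proof.
rewrite !det4E /offdiag_sum /orth_point !big_ord_recl !big_ord0 /=.
rewrite /bump /=; ring.
Qed.

(** At this point column 2, and also the sum of columns 0 and 1, is zero outside one row, so the
    determinant splits into three factors. *)
Lemma det_cubic10 (R : comNzRingType) (p : nat -> nat -> R) (b c : nat -> R) :
  \det (cubic_mx p b (orth_point c 1 0)) =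
  - (p 2%N 0%N * c 1%N - p 2%N 1%N * c 0%N)
  * (p 3%N 0%N * c 1%N - p 3%N 1%N * c 0%N)
  * (p 1%N 0%N * c 1%N * b 0%N - p 0%N 1%N * c 0%N * b 1%N).
Proof.
rewrite !det4E /offdiag_sum /orth_point !big_ord_recl !big_ord0 /=.
rewrite /bump /=; ring.
Qed.

(** Here columns 0 and 1 are zero off the diagonal. *)
Lemma det_cubic01 (R : comNzRingType) (p : nat -> nat -> R) (b c : nat -> R) :
  \det (cubic_mx p b (orth_point c 0 1)) =
  - (p 0%N 2%N * c 3%N - p 0%N 3%N * c 2%N)
  * (p 1%N 2%N * c 3%N - p 1%N 3%N * c 2%N)
  * (p 3%N 2%N * c 3%N * b 2%N - p 2%N 3%N * c 2%N * b 3%N).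
Proof.
rewrite !det4E /offdiag_sum /orth_point !big_ord_recl !big_ord0 /=.
rewrite /bump /=; ring.
Qed.

Definition ulE (R : comNzRingType) (M : 'M[R]_(4 + 1)) (i j : nat) : R :=
  ulsubmx M (inord i) (inord j).
Definition urE (R : comNzRingType) (M : 'M[R]_(4 + 1)) (i : nat) : R :=
  ursubmx M (inord i) 0.
Definition dlE (R : comNzRingType) (M : 'M[R]_(4 + 1)) (j : nat) : R :=
  dlsubmx M 0 (inord j).

(** The determinants are the values of the cubic at the two vectors spanning the path used below;
    nonzero [c] makes all coordinates of [orth_point c s y] nonzero for nonzero [s] and [y]. *)
Definition genericity (R : comNzRingType) (p : nat -> nat -> R)
    (b c : nat -> R) : R :=
  c 0%N * c 1%N * c 2%N * c 3%N * \det (cubic_mx p b (orth_point c 1 0))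
  * \det (cubic_mx p b (orth_point c 0 1)).

(** Along the line from [M] to [W], genericity is a polynomial in [t], nonzero because it does not
    vanish at 1, that is, at [W]. *)
Lemma exists_generic5 (R : fieldType) (O : 'M[R]_(4 + 1) -> Prop) M :
  line_open O -> O M ->
  exists2 M', O M' & genericity (ulE M') (urE M') (dlE M') != 0.
Proof.
move=> Oop OM.
(* Both factorized determinants equal -1 at [W]. *)
pose W : 'M[R]_(4 + 1) :=
  block_mx (\matrix_(i, j) (~~ odd j)%:R) (const_mx 1) (const_mx 1) 0.
have [f fE] : exists f : R -> R -> {poly R},
    forall x y t, (f x y).[t] = x + t * (y - x).
  by exists (fun x y => x%:P + 'X * (y - x)%:P) => x y t; rewrite !hornerE.
pose q := genericity (fun i j => f (ulE M i j) (ulE W i j))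
  (fun i => f (urE M i) (urE W i)) (fun i => f (dlE M i) (dlE W i)).
pose N t := M + t *: (W - M).
have qE t : q.[t] = genericity (ulE (N t)) (urE (N t)) (dlE (N t)).
  rewrite /q /genericity !(det_cubic10, det_cubic01) !hornerE !fE.
  by rewrite /ulE /urE /dlE !mxE.
have [|t qt Ot] := Oop M (W - M) q OM; last first.
  by exists (N t); rewrite // -qE.
apply/eqP=> /(congr1 (horner^~ 1)); rewrite horner0 qE /N scale1r addrC subrK.
rewrite /genericity !(det_cubic10, det_cubic01) /ulE /urE /dlE /W.
rewrite block_mxKul block_mxKur block_mxKdl !mxE !inordK //=.
by move/eqP; rewrite !(mulr1, mulr0, subr0, sub0r, mulrN, mulNr, opprK)
  ?oppr_eq0 oner_eq0.
Qed.

(* The cubic is evaluated along the path x u + (1 - x^2) u' from - u to u; as it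
   does not vanish at u and u', its zero is not at an endpoint or at u'. *)
Lemma odd_path_root (R : rcfType) (q : {poly R}) :
  q.[1] != 0 -> q.[-1] = - q.[1] -> q.[0] != 0 ->
  exists x, [/\ root q x, x != 0 & 1 - x ^+ 2 != 0].
Proof.
move=> q1 qN1 q0.
have [x qx] : exists x, root q x.
  have le11 : -1 <= 1 :> R by rewrite lerNl (le_trans _ ler01) // lerN10.
  have [q1p|q1n] := lerP 0 q.[1].
    have [|x _ ?] := @poly_ivt R q _ _ le11; last by exists x.
    by rewrite qN1 oppr_le0 q1p.
  have [|x _] := @poly_ivt R (- q) _ _ le11.
    by rewrite !hornerN qN1 opprK oppr_ge0 ltW.
  by rewrite rootN => ?; exists x.
exists x; split=> //.
  by apply: contraNneq q0 => x0; move: qx; rewrite x0.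
rewrite subr_eq0 eq_sym sqrf_eq1 negb_or; apply/andP; split.
  by apply: contraNneq q1 => x1; move: qx; rewrite x1.
by apply: contraNneq q1 => x1; move: qx; rewrite x1 /root qN1 oppr_eq0.
Qed.

Lemma corank2_diag5 (R : rcfType) (O : 'M[R]_(4 + 1) -> Prop) M :
  line_open O ->
  (forall (P P' : 'M[R]_4) b c x x', O (block_mx P b c x) ->
    (forall i j, i != j -> P' i j = P i j) -> O (block_mx P' b c x')) ->
  O M -> exists2 M', O M' & (\rank M' <= 3)%N.
Proof.
move=> Oop Os OM; have [{OM}M1 OM gen] := exists_generic5 Oop OM.
set p := ulE M1 in gen; set b := urE M1 in gen; set c := dlE M1 in gen.
have pE (i j : 'I_4) : p i j = ulsubmx M1 i j by rewrite /p /ulE !inord_val.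
have bE (i : 'I_4) : b i = ursubmx M1 i 0 by rewrite /b /urE !inord_val.
have cE (i : 'I_4) : c i = dlsubmx M1 0 i by rewrite /c /dlE !inord_val.
move: gen; rewrite !mulf_eq0 !negb_or => /andP[/andP[/andP[/andP[/andP[c0 c1]
  c2] c3] K10] K01].
pose q := \det (cubic_mx (fun i j => (p i j)%:P) (fun i => (b i)%:P)
     (orth_point (fun i => (c i)%:P) 'X (1 - 'X^2))).
have qE x : q.[x] = \det (cubic_mx p b (orth_point c x (1 - x ^+ 2))).
  by rewrite horner_det_cubic !hornerE.
have [|||x [qx x0 y0]] := @odd_path_root R q.
- by rewrite qE expr1n subrr.
- by rewrite !qE sqrrN expr1n subrr -det_cubicN oppr0.
- by rewrite qE expr0n subr0.
set y := 1 - x ^+ 2 in y0; pose v := orth_point c x y.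
have v0 (i : 'I_4) : v i != 0.
  by case: i => [[|[|[|[|i]]]] ?] //=; rewrite /v /orth_point /= ?oppr_eq0
    mulf_neq0.
pose P : 'M[R]_4 := \matrix_(i, j)
  if i == j then - offdiag_sum p v i / v i else p i j.
pose vc : 'cV[R]_4 := \col_i v i.
have Pv : P *m vc = 0.
  apply/colP=> i; rewrite !mxE (bigD1 i) //= !mxE eqxx divfK //.
  rewrite /offdiag_sum (bigD1 i) //= eqxx add0r addrC; apply/eqP.
  rewrite subr_eq0; apply/eqP; apply: eq_bigr => j ji.
  rewrite !mxE eq_sym (negPf ji).
  by have /negPf -> : (j : nat) != i by [].
have cv : dlsubmx M1 *m vc = 0.
  apply/rowP=> i; rewrite !ord1 mxE [RHS]mxE.
  under eq_bigr do rewrite [vc _ _]mxE -cE.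
  rewrite !big_ord_recl big_ord0 /v /orth_point /= /bump /=; ring.
(* A left kernel vector of the cubic matrix kills [b] and, since [v] has no zero coordinate, the
   first three columns of [P]. *)
have /det0P[w w0 wN] : \det (cubic_mx p b v) == 0.
  by move: qx; rewrite /root qE.
have wNj j : \sum_i w 0 i * cubic_mx p b v i j = 0.
  by move/rowP/(_ j): wN; rewrite !mxE.
have wb : w *m ursubmx M1 = 0.
  apply/rowP=> i; rewrite !ord1 mxE [RHS]mxE; apply: etrans (wNj ord_max).
  by apply: eq_bigr => k _; rewrite [cubic_mx _ _ _ _ _]mxE /= bE.
have wP3 (j : 'I_4) : j != ord_max -> (w *m P) 0 j = 0.
  move=> j3; apply: (mulIf (v0 j)); rewrite mul0r mxE mulr_suml.
  apply: etrans (wNj j); apply: eq_bigr => i _; rewrite !mxE.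
  have /negPf -> : (j : nat) != 3%N by [].
  by rewrite -val_eqE -mulrA; case: eqP => [/= <-|//]; rewrite divfK.
(* The last column follows from [w P v = 0], as the last coordinate of [v] is nonzero. *)
have wP : w *m P = 0.
  apply/rowP=> j; rewrite [RHS]mxE; have [->|/wP3//] := eqVneq j ord_max.
  apply: (mulIf (v0 ord_max)); rewrite mul0r.
  have := congr1 (fun A : 'M[R]_1 => A 0 0) (mulmxA w P vc).
  rewrite Pv mulmx0 [LHS]mxE [RHS]mxE (bigD1 ord_max) //= big1 ?addr0.
    by rewrite [vc _ _]mxE => <-.
  by move=> i /wP3 ->; rewrite mul0r.
have vc0 : vc != 0.
  by apply: contraNneq (v0 0) => /colP/(_ 0); rewrite !mxE => ->.
apply: (@corank2_bordered R 3 O P (ursubmx M1) (dlsubmx M1) 0 vc w) => //.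
  by move=> P1 b1 c1' x1 x1' /Os; apply.
rewrite -[M1]submxK in OM; apply: Os OM _ => i j ij.
by rewrite mxE (negPf ij) pE.
Qed.

(** * Reduction to a leading block by permutations and Schur complements *)

Lemma perm_of_seqs (T : finType) (s1 s2 : seq T) :
  uniq s1 -> uniq s2 -> size s1 = size s2 ->
  exists s : {perm T}, map s s1 = s2.
Proof.
elim: s1 s2 => [|x1 s1 IH] [|x2 s2] //=; first by exists 1%g.
move=> /andP[x1s1 us1] /andP[x2s2 us2] [ss].
have [s sE] := IH _ us1 us2 ss; exists (s * tperm (s x1) x2)%g.
rewrite permM tpermL; congr (_ :: _); rewrite -[RHS]sE; apply/eq_in_map=> y ys1.
rewrite permM tpermD //.
  by rewrite (inj_eq perm_inj); apply: contraNneq x1s1 => ->.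
by apply: contraNneq x2s2 => ->; rewrite -sE map_f.
Qed.

Lemma mxrank_perm (R : fieldType) n (s t : 'S_n) (M : 'M[R]_n) :
  \rank (row_perm s (col_perm t M)) = \rank M.
Proof.
rewrite row_permE (eqmxMfull _ _) ?row_full_unit ?unitmx_perm //.
by rewrite col_permE mxrankMfree // row_free_unit unitmx_perm.
Qed.

(** Block factorization with unipotent outer factors. *)
Lemma schur_rank (R : fieldType) m k (X : 'M[R]_m) (Y : 'M[R]_(m, k))
    (Z : 'M[R]_(k, m)) (T : 'M[R]_k) :
  T \in unitmx ->
  \rank (block_mx X Y Z T) = (\rank (X - Y *m invmx T *m Z)%R + k)%N.
Proof.
move=> Tu; have -> : block_mx X Y Z T = block_mx 1%:M (Y *m invmx T) 0 1%:M *m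
    (block_mx (X - Y *m invmx T *m Z) 0 0 T *m
     block_mx 1%:M 0 (invmx T *m Z) 1%:M).
  rewrite !mulmx_block !(mul1mx, mulmx1, mul0mx, mulmx0, addr0, add0r).
  by rewrite mulmxKV // mulKVmx // subrK.
rewrite (eqmxMfull _ _); last first.
  by rewrite row_full_unit unitmxE det_ublock !det1 mulr1 unitr1.
rewrite mxrankMfree; last first.
  by rewrite row_free_unit unitmxE det_lblock !det1 mulr1 unitr1.
by rewrite rank_diag_block_mx (mxrank_unit Tu).
Qed.

(** Here [F] is affine with linear part [G]. *)
Lemma line_open_affine (R : fieldType) m n p q (O : 'M[R]_(p, q) -> Prop)
    (F G : 'M[R]_(m, n) -> 'M[R]_(p, q)) :
  (forall M N t, F (M + t *: N) = F M + t *: G N) ->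
  line_open O -> line_open (fun M => O (F M)).
Proof.
move=> FG Oop M N p0 OM p00; have [t pt Ot] := Oop _ (G N) _ OM p00.
by exists t; rewrite ?FG.
Qed.

Lemma corank2_matching (R : rcfType) k
    (U : {set 'I_(4 + 1 + k) * 'I_(4 + 1 + k)})
    (O : 'M[R]_(4 + 1 + k) -> Prop) M (s t : 'S_(4 + 1 + k)) :
  line_open O -> saturated U O -> O M ->
  (forall i : 'I_(4 + 1), (s (lshift k i), t (lshift k i)) \in U) ->
  exists2 M', O M' & (\rank M' + 2 <= 4 + 1 + k)%N.
Proof.
move=> Oop Os OM stU; pose F (B : 'M[R]_(4 + 1 + k)) :=
  row_perm s^-1 (col_perm t^-1 B).
have Fop : line_open (fun B => O (F B)).
  by apply: (line_open_affine (G := F)) Oop => A B x; apply/matrixP=> i j;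
    rewrite !mxE.
pose M2 := row_perm s (col_perm t M).
have OM2 : O (F M2).
  suff -> : F M2 = M by [].
  by apply/matrixP=> i j; rewrite !mxE !permKV.
have [p p0 pP] := shift_unitmx (drsubmx M2).
(* A shift of the lower right block alone makes it invertible. *)
have [x px] := Fop M2 (block_mx 0 0 0 1%:M) p OM2 p0.
rewrite -[M2]submxK scale_block_mx add_block_mx !scaler0 !addr0 scalemx1.
have := pP x px; move: (ulsubmx M2) (ursubmx M2) (dlsubmx M2) (_ + x%:M).
move=> X Y Z T Tu OXYZT {M2 OM2 p p0 pP px}.
(* [G A] has Schur complement [A], hence rank that of [A] plus [k]; changing the diagonal of [A]
   changes only entries in [U]. *)
pose G (A : 'M[R]_(4 + 1)) := block_mx (A + Y *m invmx T *m Z) Y Z T.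
have [|||A OA rA] := @corank2_diag5 R (fun A => O (F (G A)))
  (X - Y *m invmx T *m Z).
- apply: (line_open_affine (G := fun A => block_mx A 0 0 0)) Fop => A B u.
  by rewrite /G scale_block_mx add_block_mx !scaler0 !addr0 addrAC.
- move=> P P' b c z z' OP PP'; apply: Os OP _ => i j ij.
  rewrite ![F _ _ _]mxE ![col_perm _ _ _ _]mxE.
  set i' := (s^-1)%g i; set j' := (t^-1)%g j.
  have sti : i = s i' /\ j = t j' by rewrite !permKV.
  rewrite -(fintype.splitK i') -(fintype.splitK j').
  case: (fintype.split i') (fintype.splitK i') => [a|a] ia;
    case: (fintype.split j') (fintype.splitK j') => [d|d] jd;
    rewrite /unsplit /G ?block_mxEul ?block_mxEur ?block_mxEdl ?block_mxEdr //.
  rewrite [LHS]mxE [RHS]mxE; congr (_ + _).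
  rewrite -(fintype.splitK a) -(fintype.splitK d).
  have ad : a != d.
    apply: contraNneq ij => ad; case: sti => -> ->; rewrite -ia -jd ad.
    exact: stU.
  case: (fintype.split a) (fintype.splitK a) => [a'|a'] aE;
    case: (fintype.split d) (fintype.splitK d) => [d'|d'] dE;
    rewrite /unsplit ?block_mxEul ?block_mxEur ?block_mxEdl ?block_mxEdr //.
    by apply: PP'; apply: contraNneq ad => ad'; rewrite -aE -dE ad'.
  by case/eqP: ad; rewrite -aE -dE !ord1.
- by rewrite /G subrK.
exists (F (G A)) => //.
rewrite mxrank_perm schur_rank // addrK; lia.
Qed.

(** * Ruling out corank two on an open set *)

Lemma cofactor_eq (R : comPzRingType) n (M M' : 'M[R]_n) i j :
  (forall k l, k != i -> l != j -> M' k l = M k l) ->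
  cofactor M' i j = cofactor M i j.
Proof.
move=> MM'; rewrite /cofactor; congr (_ * \det _).
by apply/matrixP=> k l; rewrite !mxE MM' // eq_sym neq_lift.
Qed.

Lemma det_add_delta (R : comPzRingType) n (M : 'M[R]_n) a i j :
  \det (M + a *: delta_mx i j) = \det M + a * cofactor M i j.
Proof.
rewrite !(expand_det_row _ i).
under eq_bigr => l _.
  rewrite (_ : cofactor _ i l = cofactor M i l); last first.
    by apply: cofactor_eq => k l' ki _; rewrite !mxE (negPf ki) mulr0 addr0.
  rewrite !mxE eqxx mulrDl; over.
rewrite big_split /=; congr (_ + _).
rewrite (bigD1 j) //= eqxx mulr1 big1 ?addr0 // => l /negPf lj.
by rewrite lj mulr0 mul0r.
Qed.

(** If [M] is singular, adding a matrix unit, of rank one, makes the determinant equal to the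
    nonzero cofactor. *)
Lemma cofactor_rank (R : fieldType) n (M : 'M[R]_n) i j :
  cofactor M i j != 0 -> (n <= \rank M + 1)%N.
Proof.
move=> cM; have [/eqP d0|d0] := eqVneq (\det M) 0; last first.
  by rewrite (@mxrank_unit _ _ M) ?leq_addr // unitmxE unitfE.
have := mxrank_add M (delta_mx i j); rewrite mxrank_delta; apply: leq_trans.
rewrite mxrank_unit // unitmxE unitfE -[delta_mx i j]scale1r det_add_delta.
by rewrite (eqP d0) add0r mul1r.
Qed.

(** The determinant is affine in the entry [(i, j)], with the cofactor as slope. *)
Lemma singular_shift (R : fieldType) n (M : 'M[R]_n) i j :
  (0 < n)%N -> cofactor M i j != 0 ->
  (\rank (M - (\det M / cofactor M i j) *: delta_mx i j)%R <= n.-1)%N.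
Proof.
move=> n0 cM; rewrite -ltnS prednK // ltn_neqAle rank_leq_row andbT.
apply/negP=> /eqP rM.
have : row_free (M - (\det M / cofactor M i j) *: delta_mx i j).
  by rewrite /row_free rM.
by rewrite row_free_unit unitmxE unitfE -scaleNr det_add_delta mulNr divfK //
  subrr eqxx.
Qed.

Lemma exists_nonzero_cofactors (R : numFieldType) n :
  exists M : 'M[R]_n, forall i j, cofactor M i j != 0.
Proof.
(* The left and right kernels of n I - J are spanned by the all-one vector. *)
pose M : 'M[R]_n := n%:R%:M - const_mx 1; exists M => i j.
have n0 : n%:R != 0 :> R by rewrite pnatr_eq0 -lt0n; case: (n) i => [[]|].
have wM (w : 'rV_n) l : (w *m M) 0 l = n%:R * w 0 l - \sum_k w 0 k.
  rewrite mulmxBr mul_mx_scalar !mxE; congr (_ - _).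
  by apply: eq_bigr => k _; rewrite mxE mulr1.
have dM : \det M = 0.
  apply/eqP/det0P; exists (const_mx 1).
    by apply/rV0Pn; exists i; rewrite mxE oner_eq0.
  apply/rowP=> l; rewrite wM !mxE mulr1.
  under eq_bigr do rewrite mxE.
  by rewrite sumr_const card_ord subrr.
have : \det (M + 1 *: delta_mx i j) != 0; last first.
  by rewrite det_add_delta dM add0r mul1r.
rewrite scale1r; apply/det0P=> -[w w0].
rewrite mulmxDr mul_row_delta => /rowP wMd.
have wj l : n%:R * w 0 l - \sum_k w 0 k + w 0 i * (l == j)%:R = 0.
  by have := wMd l; rewrite mxE wM !mxE eqxx.
(* Summing the equations [wj] over all columns leaves only [w 0 i]. *)
have wi : w 0 i = 0.
  have : \sum_l (n%:R * w 0 l - \sum_k w 0 k + w 0 i * (l == j)%:R) = 0.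
    by rewrite big1 // => l _; apply: wj.
  rewrite big_split sumrB /= -!mulr_sumr sumr_const card_ord mulr_natl subrr.
  rewrite add0r (bigD1 j) //= eqxx big1 ?addr0 ?mulr1 // => l /negPf -> //.
have S0 : \sum_k w 0 k = 0.
  by have := wj i; rewrite wi mulr0 mul0r addr0 sub0r => /eqP;
    rewrite oppr_eq0 => /eqP.
case/eqP: w0; apply/rowP=> l; have := wj l.
rewrite wi S0 mul0r subr0 addr0 mxE => /eqP.
by rewrite mulf_eq0 (negPf n0) => /eqP.
Qed.

(** * Witnesses against corank two for three and four diagonal entries *)

Lemma rank_factor (R : fieldType) m n k (X : 'M[R]_(m, n)) :
  (\rank X <= k)%N ->
  exists (B : 'M[R]_(m, k)) (C : 'M[R]_(k, n)), X = B *m C.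
Proof.
move=> rX; exists (col_ebase X *m pid_mx (\rank X)),
  (pid_mx (\rank X) *m row_ebase X).
rewrite mulmxA -(mulmxA (col_ebase X)) mul_pid_mx.
by rewrite minnn (minn_idPr rX) mulmx_ebase.
Qed.

(** The square turns nonvanishing into positivity, the form shared with the 4 x 4 case. *)
Definition witness3 (R : comNzRingType) (X : 'M[R]_3) : R :=
  let x i j := X (inord i) (inord j) in
  (x 0%N 1%N * x 1%N 2%N * x 2%N 0%N - x 0%N 2%N * x 1%N 0%N * x 2%N 1%N) ^+ 2.

Lemma witness3_diag (R : comNzRingType) (X X' : 'M[R]_3) :
  (forall i j, i != j -> X' i j = X i j) -> witness3 X' = witness3 X.
Proof.
by move=> XX'; rewrite /witness3 !XX' // -val_eqE /= !inordK.
Qed.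

(** For a column [B] times a row [C], both cyclic products equal the product of all entries of [B]
    and [C]. *)
Lemma witness3_rank (R : realFieldType) (X : 'M[R]_3) :
  0 < witness3 X -> (3 <= \rank X + 1)%N.
Proof.
have [//|] := leqP 3 (\rank X + 1); rewrite addn1 ltnS => rX.
have [B [C ->]] := rank_factor rX.
rewrite /witness3 !mxE !big_ord1 [X in X ^+ 2](_ : _ = 0) ?expr0n ?ltxx //.
by ring.
Qed.

(* The minors of rows 0,1,2 and columns 0,1,3, and of rows 0,1,3 and columns
   0,1,2 have the form p x y + q x + r y + s, where x and y are the first two
   diagonal entries. Eliminating y leaves a quadratic equation in x, whose
   discriminant is the opposite of [witness4]. *)
Definition witness4 (R : comNzRingType) (X : 'M[R]_4) : R :=
  let x i j := X (inord i) (inord j) in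
  let q k l := - (x 1%N l * x k 1%N) in
  let r k l := - (x 0%N l * x k 0%N) in
  let s k l := x 0%N 1%N * x 1%N l * x k 0%N + x 0%N l * x 1%N 0%N * x k 1%N
    - x 0%N 1%N * x 1%N 0%N * x k l in
  let p := x 2%N 3%N in let p' := x 3%N 2%N in
  let q1 := q 2%N 3%N in let q2 := q 3%N 2%N in
  let r1 := r 2%N 3%N in let r2 := r 3%N 2%N in
  let s1 := s 2%N 3%N in let s2 := s 3%N 2%N in
  4 * (p * q2 - p' * q1) * (r1 * s2 - r2 * s1)
  - (p * s2 + r1 * q2 - p' * s1 - r2 * q1) ^+ 2.

Lemma witness4_diag (R : comNzRingType) (X X' : 'M[R]_4) :
  (forall i j, i != j -> X' i j = X i j) -> witness4 X' = witness4 X.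
Proof.
by move=> XX'; rewrite /witness4 !XX' // -val_eqE /= !inordK.
Qed.

(** Multiplying the second equation by [p x + r], the first by [p' x + r'] and subtracting removes
    [y]; completing the square in the resulting quadratic in [x] gives the identity. *)
Lemma discriminant_eliminant (R : comNzRingType) (p q r s p' q' r' s' x y : R) :
  p * x * y + q * x + r * y + s = 0 ->
  p' * x * y + q' * x + r' * y + s' = 0 ->
  4 * (p * q' - p' * q) * (r * s' - r' * s)
    - (p * s' + r * q' - p' * s - r' * q) ^+ 2 =
  - (2 * (p * q' - p' * q) * x + (p * s' + r * q' - p' * s - r' * q)) ^+ 2.
Proof.
move=> e e'; set lhs := LHS.
have -> : lhs = lhs - 4 * (p * q' - p' * q) *
    ((p * x + r) * (p' * x * y + q' * x + r' * y + s')
     - (p' * x + r') * (p * x * y + q * x + r * y + s)).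
  by rewrite e e' !mulr0 subr0 mulr0 subr0.
by rewrite /lhs; ring.
Qed.

Lemma witness4_rank (R : realFieldType) (X : 'M[R]_4) :
  0 < witness4 X -> (4 <= \rank X + 1)%N.
Proof.
have [//|] := leqP 4 (\rank X + 1); rewrite addn1 ltnS => rX.
have [B [C ->]] := rank_factor rX.
pose x i j := (B *m C) (inord i) (inord j).
have xE i j : x i j =
    B (inord i) 0 * C 0 (inord j) + B (inord i) 1 * C 1 (inord j).
  by rewrite /x mxE !big_ord_recl big_ord0 addr0; congr (_ + B _ _ * C _ _);
    apply/val_inj.
(* The minor of rows 0, 1, [k] and columns 0, 1, [l] vanishes in rank at most 2. *)
have E k l : x k l * x 0%N 0%N * x 1%N 1%N + - (x 1%N l * x k 1%N) * x 0%N 0%N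
  + - (x 0%N l * x k 0%N) * x 1%N 1%N + (x 0%N 1%N * x 1%N l * x k 0%N
  + x 0%N l * x 1%N 0%N * x k 1%N - x 0%N 1%N * x 1%N 0%N * x k l) = 0.
  by rewrite !xE; ring.
have := discriminant_eliminant (E 2%N 3%N) (E 3%N 2%N).
rewrite -/(witness4 (B *m C)) => ->.
by rewrite oppr_gt0 ltNge sqr_ge0.
Qed.

(** The second condition says that the cofactor [(i, i)] is nonzero, in a form suited to explicit
    determinants. *)
Lemma witness3_example (R : realFieldType) : exists X : 'M[R]_3,
  0 < witness3 X /\ exists i, \det (X + delta_mx i i) != \det X.
Proof.
pose s : seq (seq R) := [:: [:: 1; 1; 0]; [:: 0; 1; 1]; [:: 1; 0; 0]].
pose a i j := nth 0 (nth [::] s i) j.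
exists (\matrix_(i < 3, j < 3) a i j); split.
  by rewrite /witness3 !mxE !inordK //= /a /=; lra.
exists ord_max.
pose a' i j := a i j + if (i == 2%N) && (j == 2%N) then 1 else 0.
have -> : \matrix_(i < 3, j < 3) a i j + delta_mx ord_max ord_max =
  \matrix_(i < 3, j < 3) a' i j.
  by apply/matrixP=> i j; rewrite !mxE /a' -!val_eqE /=; case: ifP.
by rewrite !det3E /a' /a /= -subr_eq0; apply: lt0r_neq0; lra.
Qed.

Lemma witness4_example (R : realFieldType) : exists X : 'M[R]_4,
  0 < witness4 X /\ exists i, \det (X + delta_mx i i) != \det X.
Proof.
(* For this matrix the quadratic obtained by elimination is [x^2 + 1]. *)
pose s : seq (seq R) :=
  [:: [:: 0; 1; 0; 1]; [:: -1; 0; -2; 1]; [:: 1; 1; 0; 0]; [:: 1; 0; 1; 0]].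
pose a i j := nth 0 (nth [::] s i) j.
exists (\matrix_(i < 4, j < 4) a i j); split.
  by rewrite /witness4 !mxE !inordK //= /a /=; lra.
exists ord_max.
pose a' i j := a i j + if (i == 3%N) && (j == 3%N) then 1 else 0.
have -> : \matrix_(i < 4, j < 4) a i j + delta_mx ord_max ord_max =
  \matrix_(i < 4, j < 4) a' i j.
  by apply/matrixP=> i j; rewrite !mxE /a' -!val_eqE /=; case: ifP.
rewrite !det4E /a' /a /= -subr_eq0 -oppr_eq0; apply: lt0r_neq0; lra.
Qed.

(** The Schur complement times the determinant of the lower right block: polynomial in the entries,
    hence continuous everywhere. *)
Definition schur_num (R : comNzRingType) m k (M : 'M[R]_(m + k)) : 'M[R]_m :=
  \det (drsubmx M) *: ulsubmx M - ursubmx M *m \adj (drsubmx M) *m dlsubmx M.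

Lemma schur_num_rank (R : fieldType) m k (M : 'M[R]_(m + k)) :
  \det (drsubmx M) != 0 -> (m <= \rank (schur_num M) + 1)%N ->
  (m + k <= \rank M + 1)%N.
Proof.
move=> d0; have Tu : drsubmx M \in unitmx by rewrite unitmxE unitfE.
rewrite -{2}[M]submxK schur_rank //.
have -> : schur_num M = \det (drsubmx M) *:
    (ulsubmx M - ursubmx M *m invmx (drsubmx M) *m dlsubmx M).
  rewrite /schur_num scalerBr /invmx Tu -scalemxAr -scalemxAl scalerA.
  by rewrite divff // scale1r.
by rewrite (eqmx_scale _ d0); lia.
Qed.

(** * Continuity of polynomial expressions in the entries *)

Definition entry_continuous (R : realType) (T : topologicalType) m n
    (F : T -> 'M[R]_(m, n)) :=
  forall i j, continuous (fun x => F x i j : R).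

Lemma continuous_sumr (R : realType) (T : topologicalType) (I : Type)
    (r : seq I) (P : pred I) (F : I -> T -> R) :
  (forall i, P i -> continuous (F i)) ->
  continuous (fun x => \sum_(i <- r | P i) F i x).
Proof. by apply: continuous_big; exact: add_continuous. Qed.

Lemma continuous_prodr (R : realType) (T : topologicalType) (I : Type)
    (r : seq I) (P : pred I) (F : I -> T -> R) :
  (forall i, P i -> continuous (F i)) ->
  continuous (fun x => \prod_(i <- r | P i) F i x).
Proof. by apply: continuous_big; exact: mul_continuous. Qed.

Lemma continuous_mulr (R : realType) (T : topologicalType) (f g : T -> R) :
  continuous f -> continuous g -> continuous (fun x => f x * g x).
Proof. by move=> cf cg x; apply: cvgM; [apply: cf | apply: cg]. Qed.

Lemma continuous_addr (R : realType) (T : topologicalType) (f g : T -> R) :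
  continuous f -> continuous g -> continuous (fun x => f x + g x).
Proof. by move=> cf cg x; apply: cvgD; [apply: cf | apply: cg]. Qed.

Lemma continuous_oppr (R : realType) (T : topologicalType) (f : T -> R) :
  continuous f -> continuous (fun x => - f x).
Proof. by move=> cf x; apply: cvgN; apply: cf. Qed.

Lemma continuous_expr (R : realType) (T : topologicalType) (f : T -> R) k :
  continuous f -> continuous (fun x => f x ^+ k).
Proof.
move=> cf; elim: k => [|k IH]; first by move=> x; apply: cvg_cst.
by under eq_fun do rewrite exprS; apply: continuous_mulr.
Qed.

Lemma continuous_det (R : realType) (T : topologicalType) n (F : T -> 'M[R]_n) :
  entry_continuous F -> continuous (fun x => \det (F x) : R).
Proof.
move=> cF; apply: continuous_sumr => s _; apply: continuous_mulr.
  by move=> x; apply: cvg_cst.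
by apply: continuous_prodr => i _; apply: cF.
Qed.

Lemma continuous_cofactor (R : realType) (T : topologicalType) n
    (F : T -> 'M[R]_n) i j :
  entry_continuous F -> continuous (fun x => cofactor (F x) i j : R).
Proof.
move=> cF; apply: continuous_mulr; first by move=> x; apply: cvg_cst.
apply: continuous_det => k l.
by under eq_fun do rewrite !mxE; apply: cF.
Qed.

Lemma entry_continuous_mul (R : realType) (T : topologicalType) m n p
    (F : T -> 'M[R]_(m, n)) (G : T -> 'M[R]_(n, p)) :
  entry_continuous F -> entry_continuous G ->
  entry_continuous (fun x => F x *m G x).
Proof.
move=> cF cG i j; under eq_fun do rewrite mxE.
apply: continuous_sumr => k _.
by apply: continuous_mulr; [apply: cF | apply: cG].
Qed.

Lemma entry_continuous_schur (R : realType) (T : topologicalType) m k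
    (F : T -> 'M[R]_(m + k)) :
  entry_continuous F -> entry_continuous (fun x => schur_num (F x)).
Proof.
move=> cF.
have cul : entry_continuous (fun x => ulsubmx (F x)).
  by move=> i j; under eq_fun do rewrite !mxE; apply: cF.
have cur : entry_continuous (fun x => ursubmx (F x)).
  by move=> i j; under eq_fun do rewrite !mxE; apply: cF.
have cdl : entry_continuous (fun x => dlsubmx (F x)).
  by move=> i j; under eq_fun do rewrite !mxE; apply: cF.
have cdr : entry_continuous (fun x => drsubmx (F x)).
  by move=> i j; under eq_fun do rewrite !mxE; apply: cF.
move=> i j.
have -> : (fun x => schur_num (F x) i j) = (fun x => \det (drsubmx (F x)) *
    ulsubmx (F x) i j - (ursubmx (F x) *m \adj (drsubmx (F x)) *m
      dlsubmx (F x)) i j).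
  apply/funext => x; rewrite /schur_num.
  by rewrite [LHS]mxE [X in X + _]mxE [X in _ + X]mxE.
apply: continuous_addr.
  by apply: continuous_mulr; [exact: continuous_det | apply: cul].
apply: continuous_oppr; apply: entry_continuous_mul => //.
apply: entry_continuous_mul => // a b.
by under eq_fun do rewrite mxE; apply: continuous_cofactor.
Qed.

(** * Partial fillings, their completions and sufficiency *)

Definition restriction (R : realType) n (S : {set 'I_n * 'I_n})
    (M : 'M[R]_n) : partial_filling R S :=
  fun p => M (val p).1 (val p).2.
Arguments restriction {R n} S M.

Definition extension (R : realType) n (S : {set 'I_n * 'I_n}) (M0 : 'M[R]_n)
    (A : partial_filling R S) : 'M[R]_n :=
  \matrix_(i, j) oapp A (M0 i j) (insub (i, j)).

Lemma extension_completion (R : realType) n (S : {set 'I_n * 'I_n})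
    (M0 : 'M[R]_n) (A : partial_filling R S) : completion A (extension M0 A).
Proof. by move=> p; rewrite mxE -surjective_pairing valK. Qed.

Lemma extension_restriction (R : realType) n (S : {set 'I_n * 'I_n})
    (M : 'M[R]_n) : extension M (restriction S M) = M.
Proof.
apply/matrixP=> i j; rewrite mxE.
by case: insubP => //= u _ uE; rewrite /restriction /= uE.
Qed.

Lemma completion_eq (R : realType) n (U : {set 'I_n * 'I_n})
    (A : partial_filling R (~: U)) (M M' : 'M[R]_n) :
  completion A M -> completion A M' ->
  forall i j, (i, j) \notin U -> M' i j = M i j.
Proof.
move=> cM cM' i j; rewrite -finset.in_setC => ij.
pose u : {p | p \in (~: U)%SET} := exist _ (i, j) ij.
by have := cM u; rewrite -(cM' u).
Qed.

Lemma proj_ptws_continuous (R : realType) n (S : {set 'I_n * 'I_n}) p :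
  continuous (fun A : partial_filling R S => A p : R).
Proof.
by have H := (@proj_continuous {p : 'I_n * 'I_n | p \in S} (fun _ => R) p).
Qed.

Lemma extension_continuous (R : realType) n (S : {set 'I_n * 'I_n})
    (M0 : 'M[R]_n) : entry_continuous (@extension R n S M0).
Proof.
move=> i j; case E : (insub (i, j) : option {p | p \in S}) => [u|].
  have -> : (fun A => extension M0 A i j) = (fun A => A u).
    by apply/funext => A; rewrite mxE E.
  exact: proj_ptws_continuous.
have -> : (fun A : partial_filling R S => extension M0 A i j) = cst (M0 i j).
  by apply/funext => A; rewrite mxE E.
exact: cst_continuous.
Qed.

Lemma sub_delta_entry (R : pzRingType) m n (M : 'M[R]_(m, n)) a i j k l :
  (k, l) != (i, j) -> (M - a *: delta_mx i j) k l = M k l.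
Proof. by rewrite xpair_eqE !mxE => /negPf ->; rewrite mulr0 subr0. Qed.

(** As [g] depends only on specified entries, its positivity bounds the rank of every completion;
    the nonzero cofactor at an entry of [U] lets that entry make a completion singular. *)
Lemma typical_corank1_suff (R : realType) n (U : {set 'I_n * 'I_n})
    (g : 'M[R]_n -> R) (M0 : 'M[R]_n) i j :
  (forall (T : topologicalType) (F : T -> 'M[R]_n),
     entry_continuous F -> continuous (fun x => g (F x))) ->
  (forall M, 0 < g M -> (n <= \rank M + 1)%N) ->
  (forall M M' : 'M[R]_n, (forall k l, (k, l) \notin U -> M' k l = M k l) ->
     g M' = g M) ->
  0 < g M0 -> (i, j) \in U -> cofactor M0 i j != 0 ->
  typical_corank R (~: U)%SET 1.
Proof.
move=> gcont grank gU gM0 ijU cM0.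
have n0 : (0 < n)%N by apply: leq_ltn_trans (leq0n i) (ltn_ord i).
pose ext := @extension R n (~: U) M0.
(* The cofactor may involve unspecified entries; these are frozen at their values in [M0]. *)
pose O : set (partial_filling R (~: U)) :=
  ([set A | 0 < g (ext A)] `&` [set A | 0 < cofactor (ext A) i j ^+ 2])%classic.
exists n.-1; split; last by lia.
exists O; split.
- apply: openI.
    apply: (@open_comp _ _ _ [set x : R | 0 < x]%classic); last exact: open_gt.
    by move=> x _; apply: gcont; apply: extension_continuous.
  apply: (@open_comp _ _ (fun A => cofactor (ext A) i j ^+ 2 : R)
    [set x : R | 0 < x]%classic); last exact: open_gt.
  move=> x _; apply: continuous_expr; apply: continuous_cofactor.
  exact: extension_continuous.
- exists (restriction (~: U) M0); rewrite /O /= /ext extension_restriction.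
  by split=> //=; rewrite lt0r sqrf_eq0 cM0 sqr_ge0.
move=> A [/= gA]; rewrite lt0r sqrf_eq0 => /andP[cA _].
have minA M : completion A M -> (n.-1 <= \rank M)%N.
  move=> cM; have -> // : (n.-1 <= \rank M)%N = (n <= \rank M + 1)%N by lia.
  apply: grank; rewrite (gU (ext A)) //.
  exact: completion_eq (extension_completion _ _) cM.
split; last exact: minA.
exists (ext A - (\det (ext A) / cofactor (ext A) i j) *: delta_mx i j).
have cA' : completion A
    (ext A - (\det (ext A) / cofactor (ext A) i j) *: delta_mx i j).
  move=> p; rewrite -(extension_completion M0 A p) -/ext.
  apply: sub_delta_entry; apply: contraTneq (valP p) => pij.
  by rewrite inE negbK [val p]surjective_pairing pij.
by split=> //; apply/eqP; rewrite eqn_leq singular_shift //= minA.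
Qed.

Lemma permute_positions_in n (s t : 'S_n) (U : {set 'I_n * 'I_n}) i j :
  ((s i, t j) \in permute_positions s t U) = ((i, j) \in U).
Proof.
have inj : injective (fun p : 'I_n * 'I_n => (s p.1, t p.2)).
  by move=> [a b] [c d] /= [/perm_inj-> /perm_inj->].
by rewrite -[(s i, t j)]/((fun p => (s p.1, t p.2)) (i, j)) mem_imset.
Qed.

Lemma typical_corank1_G1 (R : realType) n (U : {set 'I_n * 'I_n}) m
    (f : 'M[R]_m -> R) :
  (forall (T : topologicalType) (F : T -> 'M[R]_m),
     entry_continuous F -> continuous (fun x => f (F x))) ->
  (forall X, 0 < f X -> (m <= \rank X + 1)%N) ->
  (forall X X' : 'M[R]_m, (forall i j, i != j -> X' i j = X i j) ->
     f X' = f X) ->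
  (exists X, 0 < f X /\ exists i, \det (X + delta_mx i i) != \det X) ->
  equals_G1_up_to_perm U m -> typical_corank R (~: U)%SET 1.
Proof.
move=> fcont frank fdiag [X0 [fX0 [i0 dX0]]] [le_mn [s [t]]].
have [k E] : exists k, n = (m + k)%N by exists (n - m)%N; rewrite subnKC.
subst n => stU.
have inU a b : ((a, b) \in U) =
    [exists i : 'I_m, (s a == lshift k i) && (t b == lshift k i)].
  rewrite -(permute_positions_in s t) stU; apply/imsetP/existsP.
    move=> [i _ [-> ->]]; exists i.
    by rewrite -!val_eqE /= eqxx.
  move=> [i /andP[/eqP-> /eqP->]]; exists i => //.
  by congr (_, _); apply/val_inj.
pose B (M : 'M[R]_(m + k)) := row_perm s^-1 (col_perm t^-1 M).
have BE M a b : B M a b = M ((s^-1)%g a) ((t^-1)%g b) by rewrite !mxE.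
have BK N : B (row_perm s (col_perm t N)) = N.
  by apply/matrixP=> a b; rewrite BE !mxE !permKV.
have detB M : \det (B M) =
    \det (perm_mx s^-1) * \det M * \det (perm_mx (t^-1)^-1).
  by rewrite /B row_permE col_permE !det_mulmx mulrA.
pose M0 := row_perm s (col_perm t (block_mx X0 0 0 1%:M)).
(* The squared determinant makes positivity force an invertible lower right block. *)
apply: (@typical_corank1_suff R (m + k) U
  (fun M => f (schur_num (B M)) * \det (drsubmx (B M)) ^+ 2) M0
  ((s^-1)%g (lshift k i0)) ((t^-1)%g (lshift k i0))).
- move=> T F cF; have cB : entry_continuous (fun x => B (F x)).
    by move=> a b; under eq_fun do rewrite BE; apply: cF.
  apply: continuous_mulr; first by apply: fcont; apply: entry_continuous_schur.
  apply: continuous_expr; apply: continuous_det => a b.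
  by under eq_fun do rewrite !mxE; apply: cF.
- move=> M gM; have d0 : \det (drsubmx (B M)) != 0.
    by apply: contraTneq gM => ->; rewrite expr0n mulr0 ltxx.
  have d2 : 0 < \det (drsubmx (B M)) ^+ 2 by rewrite lt0r sqrf_eq0 d0 sqr_ge0.
  rewrite -(mxrank_perm s^-1 t^-1 M); apply: schur_num_rank => //.
  by apply: frank; rewrite pmulr_lgt0 in gM.
(* Changing entries in [U] changes only the diagonal of the leading block of [B M]. *)
- move=> M M' MM'.
  have BM a b : (forall i, (a, b) != (lshift k i, lshift k i)) ->
      B M' a b = B M a b.
    move=> ab; rewrite !BE MM' // inU; apply/existsPn => i.
    by have := ab i; rewrite !permKV xpair_eqE.
  have dr : drsubmx (B M') = drsubmx (B M).
    apply/matrixP=> a b; rewrite [LHS]mxE [LHS]mxE [RHS]mxE [RHS]mxE BM // => i.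
    by rewrite xpair_eqE eq_rlshift.
  have ur : ursubmx (B M') = ursubmx (B M).
    apply/matrixP=> a b; rewrite [LHS]mxE [LHS]mxE [RHS]mxE [RHS]mxE BM // => i.
    by rewrite xpair_eqE eq_rlshift andbF.
  have dl : dlsubmx (B M') = dlsubmx (B M).
    apply/matrixP=> a b; rewrite [LHS]mxE [LHS]mxE [RHS]mxE [RHS]mxE BM // => i.
    by rewrite xpair_eqE eq_rlshift.
  rewrite /schur_num dr ur dl; congr (_ * _); apply: fdiag => a b ab.
  rewrite [LHS]mxE [RHS]mxE; congr (_ + _).
  rewrite [LHS]mxE [RHS]mxE; congr (_ * _).
  rewrite [LHS]mxE [LHS]mxE [RHS]mxE [RHS]mxE BM // => i.
  by rewrite xpair_eqE !eq_lshift; apply: contra ab => /andP[/eqP-> /eqP->].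
- rewrite BK /schur_num block_mxKul block_mxKur block_mxKdl block_mxKdr.
  by rewrite !mul0mx det1 scale1r subr0 expr1n mulr1.
- by rewrite inU; apply/existsP; exists i0; rewrite !permKV !eqxx.
(* Were the cofactor zero, adding the matrix unit would preserve the determinant of [M0], hence that
   of [X0]. *)
apply: contraNneq dX0 => c0.
set i := (s^-1)%g _ in c0; set j := (t^-1)%g _ in c0.
have := det_add_delta M0 1 i j; rewrite c0 mulr0 addr0 scale1r => dM0.
have : \det (B (M0 + delta_mx i j)) = \det (B M0) by rewrite !detB dM0.
have -> : B (M0 + delta_mx i j) = block_mx (X0 + delta_mx i0 i0) 0 0 1%:M.
  have -> : block_mx (X0 + delta_mx i0 i0) 0 0 1%:M =
      B M0 + block_mx (delta_mx i0 i0) 0 0 0.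
    by rewrite BK add_block_mx !addr0.
  apply/matrixP=> a b; rewrite BE [LHS]mxE -BE [RHS]mxE; congr (_ + _).
  rewrite mxE /i /j !(inj_eq perm_inj) -(fintype.splitK a) -(fintype.splitK b).
  by case: (fintype.split a) => c; case: (fintype.split b) => d;
    rewrite /unsplit ?block_mxEul ?block_mxEur ?block_mxEdl ?block_mxEdr !mxE
    ?eq_lshift ?eq_rlshift ?andbF.
by rewrite BK !det_ublock det1 !mulr1 => ->.
Qed.

(** * From a typical corank to a line-open set of matrices *)

Lemma restriction_line_continuous (R : realType) n (S : {set 'I_n * 'I_n})
    (M N : 'M[R]_n) :
  continuous (fun t : R => restriction S (M + t *: N)).
Proof.
(* The product topology is a supremum of topologies induced by coordinates, so convergence is
   checked coordinatewise. *)
move=> t; apply/cvg_sup => p W [V] [[Q] oQ <-] Qt QW.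
apply: (filterS QW) => {W QW}.
pose f (x : R) : R := M (val p).1 (val p).2 + x * N (val p).1 (val p).2.
have cf : continuous f.
  apply: continuous_addr; first exact: cst_continuous.
  by apply: continuous_mulr; [move=> x; apply: cvg_id | exact: cst_continuous].
have E x : restriction S (M + x *: N) p = f x.
  by rewrite /restriction !mxE.
have : nbhs t (f @^-1` Q)%classic.
  apply: cf; apply: open_nbhs_nbhs; split=> //.
  by rewrite -E.
by apply: filterS => x /=; rewrite /preimage /= -E.
Qed.

(** There are as many points [e / (k + 2)] as the size of [p], which exceeds its number of roots. *)
Lemma ball_nonroot (R : realType) (p : {poly R}) e :
  p != 0 -> 0 < e -> exists2 t, p.[t] != 0 & `|t| < e.
Proof.
move=> p0 e0; pose rs := [seq e / k.+2%:R | k <- iota 0 (size p)].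
have urs : uniq rs.
  rewrite map_inj_uniq ?iota_uniq // => a b /(mulfI (lt0r_neq0 e0)) /invr_inj.
  by move/eqP; rewrite eqr_nat => /eqP [].
have : ~~ all (root p) rs.
  apply/negP=> rsp; have := max_poly_roots p0 rsp urs.
  by rewrite size_map size_iota ltnn.
rewrite -has_predC => /hasP[t /mapP[k _ ->] tp]; exists (e / k.+2%:R) => //.
rewrite ger0_norm ?divr_ge0 ?ltW // ltr_pdivrMr // -{1}[e]mulr1 ltr_pM2l //.
by rewrite ltr1n.
Qed.

(** The bound on ranks will be contradicted by matrices of corank two; the singular [M'] excludes an
    empty [U]. *)
Lemma typical_corank1_line_open (R : realType) n (U : {set 'I_n * 'I_n}) :
  typical_corank R (~: U)%SET 1 ->
  exists O : 'M[R]_n -> Prop, [/\ line_open O, saturated U O,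
    exists M, O M & forall M, O M -> (n <= \rank M + 1)%N /\
      exists2 M' : 'M[R]_n, (forall i j, (i, j) \notin U -> M' i j = M i j) &
        (\rank M' < n)%N].
Proof.
move=> [r [typ nr]]; have [ O [Oop [A OA] Omin]] := typ.
exists (fun M => O (restriction (~: U) M)); split.
- move=> M N p OM p0.
  have : nbhs (0 : R)
      ((fun t : R => restriction (~: U) (M + t *: N)) @^-1` O)%classic.
    apply: restriction_line_continuous; apply: open_nbhs_nbhs; split=> //.
    by rewrite scale0r addr0.
  move=> /nbhs_ballP[e /= e0 eO].
  have [t pt te] := ball_nonroot p0 e0; exists t => //.
  by apply: eO; rewrite /ball /= sub0r normrN.
- move=> M M' OM MM'.
  suff -> : restriction (~: U) M' = restriction (~: U) M by [].
  apply/funext => p; rewrite /restriction MM' // -surjective_pairing.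
  by have := valP p; rewrite inE.
- have [ex _] := Omin _ OA; have [M [cM _]] := ex; exists M.
  suff -> : restriction (~: U) M = A by [].
  exact/funext.
move=> M OM; have [ex min] := Omin _ OM; have [M' [cM' rM']] := ex.
split; first by have := min M (fun p => erefl); lia.
exists M'; last by lia.
exact: (completion_eq (fun p => erefl) cM').
Qed.

(** * Positions in distinct rows and columns, and the final case analysis *)

Lemma equals_G1_of_matching n (U : {set 'I_n * 'I_n}) m :
  {in U &, injective fst} -> {in U &, injective snd} -> #|U| = m ->
  equals_G1_up_to_perm U m.
Proof.
move=> U1 U2 cU.
have u1 : uniq (map fst (enum U)).
  by rewrite map_inj_in_uniq ?enum_uniq // => p q; rewrite !mem_enum; apply: U1.
have u2 : uniq (map snd (enum U)).
  by rewrite map_inj_in_uniq ?enum_uniq // => p q; rewrite !mem_enum; apply: U2.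
have le_mn : (m <= n)%N.
  rewrite -cU cardE -(size_map fst) -(card_uniqP u1).
  by apply: leq_trans (max_card _) _; rewrite card_ord.
pose w := map (widen_ord le_mn) (enum 'I_m).
have uw : uniq w.
  rewrite map_inj_uniq ?enum_uniq // => a b /(congr1 val) ab.
  exact/val_inj.
have sw : size w = #|U| by rewrite size_map size_enum_ord cU.
(* The rows and the columns of [U] are sent to the first [m] indices in the same order, so each
   position lands on the diagonal; cardinalities then give equality. *)
have [s sE] := @perm_of_seqs _ (map fst (enum U)) w u1 uw
  (eq_trans (size_map _ _) (eq_trans (esym (cardE U)) (esym sw))).
have [t tE] := @perm_of_seqs _ (map snd (enum U)) w u2 uw
  (eq_trans (size_map _ _) (eq_trans (esym (cardE U)) (esym sw))).
exists le_mn, s, t; apply/eqP; rewrite eqEcard; apply/andP; split.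
  apply/fintype.subsetP=> _ /imsetP[p pU ->].
  have pe : (index p (enum U) < size (enum U))%N by rewrite index_mem mem_enum.
  have sp : s p.1 = nth (s p.1) w (index p (enum U)).
    by rewrite -[in RHS]sE -map_comp (nth_map p) //= nth_index ?mem_enum.
  have tp : t p.2 = nth (s p.1) w (index p (enum U)).
    by rewrite -[in RHS]tE -map_comp (nth_map p) //= nth_index ?mem_enum.
  have : nth (s p.1) w (index p (enum U)) \in w.
    by rewrite mem_nth // sw cardE.
  case/mapP=> i _ wi; rewrite tp wi [s p.1]sp wi.
  exact: imset_f.
apply: leq_trans (leq_imset_card _ _) _.
rewrite card_ord card_in_imset ?cU //.
by move=> [a b] [c d] _ _ /= [/perm_inj-> /perm_inj->].
Qed.

Lemma corank2_of_matching5 (R : rcfType) n (U : {set 'I_n * 'I_n})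
    (O : 'M[R]_n -> Prop) M :
  line_open O -> saturated U O -> O M ->
  {in U &, injective fst} -> {in U &, injective snd} -> (4 < #|U|)%N ->
  exists2 M', O M' & (\rank M' + 2 <= n)%N.
Proof.
move=> Oop Os OM U1 U2 cU; set e := take 5 (enum U).
have se : size e = 5%N by rewrite size_takel // -cardE.
have eU p : p \in e -> p \in U by move=> /mem_take; rewrite mem_enum.
have ue : uniq e by rewrite take_uniq ?enum_uniq.
have u1 : uniq (map fst e).
  by rewrite map_inj_in_uniq // => p q /eU pU /eU qU; apply: U1.
have u2 : uniq (map snd e).
  by rewrite map_inj_in_uniq // => p q /eU pU /eU qU; apply: U2.
have n5 : (5 <= n)%N.
  rewrite -se -(size_map fst) -(card_uniqP u1).
  by rewrite (leq_trans (max_card _)) // card_ord.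
have [k E] : exists k, n = (4 + 1 + k)%N by exists (n - 5)%N; lia.
subst n; pose w := map (lshift k) (enum 'I_(4 + 1)).
have uw : uniq w by rewrite map_inj_uniq ?enum_uniq //; apply: lshift_inj.
have sw : size w = 5%N by rewrite size_map size_enum_ord.
have [s sE] := perm_of_seqs uw u1 (etrans sw (esym (etrans (size_map _ _) se))).
have [t tE] := perm_of_seqs uw u2 (etrans sw (esym (etrans (size_map _ _) se))).
apply: (corank2_matching Oop Os OM (s := s) (t := t)) => i.
have ie : (i < size e)%N by rewrite se.
have [p0 _] : exists p0, p0 \in e.
  by case: (e) se => // p0 e' _; exists p0; rewrite mem_head.
have st (r : 'S_(4 + 1 + k)) f : map r w = map f e ->
    r (lshift k i) = f (nth p0 e i).
  move=> rE; rewrite -(nth_map _ (f p0)) // -rE (nth_map (lshift k i)) ?sw //.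
  by rewrite (nth_map i) ?size_enum_ord // nth_ord_enum.
by rewrite (st _ _ sE) (st _ _ tE) -surjective_pairing eU // mem_nth.
Qed.

Lemma not_in_one_row_and_column n (U : {set 'I_n * 'I_n}) i j :
  ~ in_one_row_and_column U -> exists2 p, p \in U & p.1 != i /\ p.2 != j.
Proof.
move=> nU; apply: contrapT => nex; apply: nU; exists i, j => p pU.
have [->|pi] := eqVneq p.1 i; first by left.
have [->|pj] := eqVneq p.2 j; first by right.
by case: nex; exists p.
Qed.

Ltac entries_continuous cF :=
  repeat match goal with
  | |- continuous (fun _ => _ + _) => apply: continuous_addr
  | |- continuous (fun _ => - _) => apply: continuous_oppr
  | |- continuous (fun _ => _ * _) => apply: continuous_mulr
  | |- continuous (fun _ => _ ^+ _) => apply: continuous_expr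
  | |- continuous (fun _ => fun_of_matrix _ _ _) => exact: cF
  | |- _ => exact: cst_continuous
  end.

Lemma continuous_witness3 (R : realType) (T : topologicalType)
    (F : T -> 'M[R]_3) :
  entry_continuous F -> continuous (fun x => witness3 (F x) : R).
Proof. by move=> cF; rewrite /witness3; entries_continuous cF. Qed.

Lemma continuous_witness4 (R : realType) (T : topologicalType)
    (F : T -> 'M[R]_4) :
  entry_continuous F -> continuous (fun x => witness4 (F x) : R).
Proof. by move=> cF; rewrite /witness4; entries_continuous cF. Qed.

Local Close Scope ring_scope.

Theorem theorem3p16 (R : realType) (n : nat) (hn : 1 <= n)
    (U : {set 'I_n * 'I_n}) :
  typical_corank R (~: U)%SET 1 <->
  [\/ 1 <= #|U| /\ in_one_row_and_column U,
      equals_G1_up_to_perm U 3 |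
      equals_G1_up_to_perm U 4].
Proof.
split; last first.
  case=> [[cU [i [j ij]]]||].
  - have [u uU] : exists u, u \in U by apply/card_gt0P.
    (* Two cofactors of [M0] matter: the one at [(i, j)], built from specified entries, bounds the
       rank, and the one at [u] permits a singular completion. *)
    have [M0 cM0] := exists_nonzero_cofactors R n.
    apply: (@typical_corank1_suff R n U (fun M => cofactor M i j ^+ 2)%R M0
      u.1 u.2).
    + by move=> T F cF; apply: continuous_expr; apply: continuous_cofactor.
    + move=> M cM; apply: (@cofactor_rank _ _ _ i j).
      by apply: contraTneq cM => ->; rewrite expr0n ltxx.
    + move=> M M' MM'; congr (_ ^+ 2)%R; apply: cofactor_eq => k l ki lj.
      apply: MM'; apply/negP => /ij /= [ki'|lj'].
        by rewrite ki' eqxx in ki.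
      by rewrite lj' eqxx in lj.
    + by rewrite lt0r sqrf_eq0 cM0 sqr_ge0.
    + by rewrite -surjective_pairing.
    + exact: cM0.
  - apply: (@typical_corank1_G1 R n U 3 (@witness3 R)).
    + exact: continuous_witness3.
    + exact: witness3_rank.
    + exact: witness3_diag.
    + exact: witness3_example.
  - apply: (@typical_corank1_G1 R n U 4 (@witness4 R)).
    + exact: continuous_witness4.
    + exact: witness4_rank.
    + exact: witness4_diag.
    + exact: witness4_example.
move=> /typical_corank1_line_open [ O [Oop Os [M OM] Omin]].
have no2 : ~ exists2 M', O M' & (\rank M' + 2 <= n)%N.
  by move=> [M' /Omin[+ _]]; lia.
(* If [U] is empty, an invertible matrix in [O] is its own only completion, which is not
   singular. *)
have [U0|Upos] := posnP #|U|.
  have [M' M'u OM'] := line_open_unitmx Oop OM; exfalso.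
  have [_ [N NM']] := Omin _ OM'.
  suff -> : N = M' by rewrite mxrank_unit // ltnn.
  by apply/matrixP=> i j; apply: NM'; rewrite (cards0_eq U0) finset.in_set0.
have [|nrc] := pselect (in_one_row_and_column U); first by constructor 1.
have U1 : {in U &, injective fst}.
  move=> [r j1] [r' j2] /= Uj1 Uj2 rr'; subst r'; congr (_, _).
  apply/eqP; apply: contra_notT no2 => j12.
  (* The second entry avoids row [r] and the column of the first, so the two lie in different
     columns. *)
  have [[p1 q1] U1 [/= p1r _]] := not_in_one_row_and_column r j1 nrc.
  have [[p2 q2] U2 [/= p2r q21]] := not_in_one_row_and_column r q1 nrc.
  by apply: (corank2_row Oop Os OM Uj1 Uj2 U1 U2); rewrite // eq_sym.
have U2 : {in U &, injective snd}.
  move=> [j1 r] [j2 r'] /= Uj1 Uj2 rr'; subst r'; congr (_, _).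
  apply/eqP; apply: contra_notT no2 => j12.
  have [[q1 p1] V1 [/= _ p1r]] := not_in_one_row_and_column j1 r nrc.
  have [[q2 p2] V2 [/= q21 p2r]] := not_in_one_row_and_column q1 r nrc.
  by apply: (corank2_col Oop Os OM Uj1 Uj2 V1 V2); rewrite // eq_sym.
have [cU|cU] := ltnP 4 #|U|.
  by case: no2; apply: corank2_of_matching5 Oop Os OM U1 U2 cU.
have [cU3|cU3] := ltnP 2 #|U|.
  have [] : #|U| = 3%N \/ #|U| = 4%N by lia.
    by move=> /(equals_G1_of_matching U1 U2); constructor 2.
  by move=> /(equals_G1_of_matching U1 U2); constructor 3.
(* At most two entries lie in the row of one and the column of the other. *)
case: nrc; have [p pU] := card_gt0P Upos.
have [U1E|[q]] := set_0Vmem (U :\ p).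
  exists p.1, p.2 => q qU; left; congr fst; apply/eqP.
  apply: contraTT isT => qp; have := finset.in_set0 q.
  by rewrite -U1E !inE qp qU.
rewrite !inE => /andP[qp qU]; exists p.1, q.2 => x xU.
have [->|xp] := eqVneq x p; first by left.
right; congr snd; apply/eqP; apply: contraTT cU3 => xq; rewrite -ltnNge.
rewrite (cardsD1 p) pU (cardsD1 q) !inE qp qU (cardsD1 x) !inE xq xp xU.
by rewrite !add1n.
Qed.
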